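(* Let $b\ge 2$ and $k\ge 1$ be integers, let $X$ be a positive continuous random variable, let $Y=\log_b X$, and let $F_{\{Y\}}$ denote the cumulative distribution function of the fractional part $\{Y\}$. Let $A_{(k)}=\lfloor b^{\{\log_b X\}+k-1}\rfloor$ be the discrete random variable modelling the $k$ most significant $b$-ary digits (the $k$-th integer significand) of $X$. Then for every $a\in\mathcal{A}_{(k)}=\{b^{k-1},\ldots,b^k-1\}$, $$\Pr(A_{(k)}=a)=F_{\{Y\}}\big(\log_b(a+1)-k+1\big)-F_{\{Y\}}\big(\log_b a-k+1\big).$$
   Context: A continuous random variable is one that has a probability density function. $\{z\}=z-\lfloor z\rfloor$ denotes the fractional part of $z\in\mathbb{R}$. $F_Z(z)=\Pr(Z\le z)$ is the cumulative distribution function; in particular $F_{\{Y\}}(y)=0$ for $y\le 0$ and $F_{\{Y\}}(y)=1$ for $y\ge 1$. For $x>0$ with $n=\lfloor\log_b x\rfloor$, the $k$-th integer significand of $x$ is $\lfloor x\,b^{-n+k-1}\rfloor=\lfloor b^{\{\log_b x\}+k-1}\rfloor$, i.e. the integer whose base-$b$ digits are the $k$ most significant $b$-ary digits of $x$. *)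

(* Defs.v *)
From HB Require Import structures.
From mathcomp Require Import all_boot all_order all_algebra.
From mathcomp Require Import all_classical all_reals all_analysis measurable_realfun.

Set Implicit Arguments.
Unset Strict Implicit.
Unset Printing Implicit Defensive.

Import Order.TTheory GRing.Theory Num.Theory.
Import numFieldNormedType.Exports.

Local Open Scope classical_set_scope.
Local Open Scope ring_scope.

(* [ln x] is the junk value 0 for [x <= 0], so [logb] is a total function. *)
Definition logb (R : realType) (b : nat) (x : R) : R := ln x / ln (b%:R : R).

Definition frac (R : realType) (z : R) : R := z - (Num.floor z)%:~R.

Lemma measurable_logb (R : realType) (b : nat) :
  measurable_fun [set: R] (@logb R b).
Proof.
by apply: measurable_funM => //; exact: measurable_ln.
Qed.

Lemma measurable_frac (R : realType) : measurable_fun [set: R] (@frac R).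
Proof.
apply: measurable_funB => //.
apply: nondecreasing_measurable => // x y xy.
by rewrite ler_int; exact: le_floor.
Qed.

HB.instance Definition _ (R : realType) (b : nat) :=
  isMeasurableFun.Build _ _ _ _ (@logb R b) (@measurable_logb R b).

HB.instance Definition _ (R : realType) :=
  isMeasurableFun.Build _ _ _ _ (@frac R) (@measurable_frac R).

Section random_variables.
Context d (T : measurableType d) (R : realType) (P : probability T R).

Definition is_density (X : {RV P >-> R}) (f : R -> R) : Prop :=
  [/\ measurable_fun [set: R] f,
      forall x, 0 <= f x &
      forall A : set R, measurable A ->
        distribution P X A = (\int[lebesgue_measure]_(x in A) (f x)%:E)%E].

Definition continuous_rv (X : {RV P >-> R}) : Prop :=
  exists f : R -> R, is_density X f.

Definition log_rv (b : nat) (X : {RV P >-> R}) : {RV P >-> R} :=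
  (@logb R b \o X : {mfun T >-> R}).

Definition frac_rv (Y : {RV P >-> R}) : {RV P >-> R} :=
  (@frac R \o Y : {mfun T >-> R}).

Definition significand (b k : nat) (X : {RV P >-> R}) (t : T) : int :=
  Num.floor ((b%:R : R) `^ (frac (logb b (X t)) + k%:R - 1)).

End random_variables.

(* Main.v *)
Require Import Defs.
From mathcomp Require Import all_boot all_order all_algebra.
From mathcomp Require Import all_classical all_reals all_analysis measurable_realfun.
Import Order.TTheory GRing.Theory Num.Theory.

Local Open Scope classical_set_scope.
Local Open Scope ring_scope.

(** Write [Z] for the fractional part of [log_b X].  The integer significand
    is the floor of [b ^ (Z + k - 1)], so it equals [a] exactly when
    [a <= b ^ (Z + k - 1) < a + 1], and taking logarithms turns this into
    [u <= Z < v] with [u = log_b a - k + 1] and [v = log_b (a + 1) - k + 1]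
    ([significand_eq_logb]).  A difference of cumulative distribution functions
    measures the event [u < Z <= v] instead, closed at the other end, so the
    formula holds as soon as [Z] has no atoms ([cdf_sub_atomless]).

    It has none ([frac_log_atomless]): on the almost sure event [0 < X], the
    value [c] of [Z] leaves for [X] only the countably many values [b ^ (n + c)],
    [n] an integer, and a variable with a density almost surely avoids any
    given countable set ([continuous_rv_countable_null]). *)

Lemma ln_nat_gt0 (R : realType) (b : nat) : (1 < b)%N -> 0 < ln (b%:R : R).
Proof. by move=> b1; rewrite ln_gt0// ltr1n. Qed.

Lemma logb_le_powR (R : realType) (b : nat) (x z : R) :
  (1 < b)%N -> 0 < x -> (logb b x <= z) = (x <= b%:R `^ z).
Proof.
move=> b1 x0; rewrite /logb ler_pdivrMr ?ln_nat_gt0// -ln_powR ler_ln//.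
by rewrite posrE powR_gt0// ltr0n ltnW.
Qed.

Lemma lt_logb_powR (R : realType) (b : nat) (x z : R) :
  (1 < b)%N -> 0 < x -> (z < logb b x) = (b%:R `^ z < x).
Proof. by move=> b1 x0; rewrite !ltNge logb_le_powR. Qed.

Lemma powR_logb (R : realType) (b : nat) (x : R) :
  (1 < b)%N -> 0 < x -> b%:R `^ logb b x = x.
Proof.
move=> b1 x0; rewrite /powR pnatr_eq0 gtn_eqF ?(ltnW b1)// /logb.
rewrite divfK ?lnK ?posrE// gt_eqF// ln_nat_gt0//.
Qed.

(** The floor equals [a] on the half-open interval from [a] to [a + 1];
    positivity of [a] is what allows taking the logarithm of both bounds. *)
Lemma significand_eq_logb (d : measure_display) (T : measurableType d)
    (R : realType) (P : probability T R) (b k a : nat) (X : {RV P >-> R})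
    (t : T) : (1 < b)%N -> (0 < a)%N ->
  (significand b k X t == a%:Z) =
  (logb b a%:R - k%:R + 1 <= frac_rv (log_rv b X) t
     < logb b (a + 1)%:R - k%:R + 1).
Proof.
move=> b1 a0; rewrite /significand floor_eq.
have -> : (a%:Z + 1)%:~R = (a + 1)%:R :> R by rewrite -PoszD.
rewrite -logb_le_powR ?ltr0z// -lt_logb_powR ?ltr0n ?addn1//.
by rewrite -addrA -lerBlDr -ltrBrDr opprB !addrA !(addrAC _ 1).
Qed.

(** The probability is the integral of the density over [C], and a countable
    set is Lebesgue-null. *)
Lemma continuous_rv_countable_null (d : measure_display) (T : measurableType d)
    (R : realType) (P : probability T R) (X : {RV P >-> R}) (C : set R) :
  continuous_rv X -> countable C -> P (X @^-1` C) = 0%E.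
Proof.
move=> [f [mf _ fE]] cC.
have mC : measurable C by exact: countable_measurable.
rewrite -[LHS]/(distribution P X C) fE//; apply: null_set_integral => //.
  by apply: measurable_funTS; exact/measurable_EFinP.
exact: countable_lebesgue_measure0.
Qed.

(** Almost sure positivity is needed in addition to the density: [logb] is
    constantly 0 on the nonpositive reals, so any mass of [X] there would become
    an atom of the fractional part at 0. *)
Lemma frac_log_atomless (d : measure_display) (T : measurableType d)
    (R : realType) (P : probability T R) (b : nat) (X : {RV P >-> R}) (c : R) :
  (1 < b)%N -> {ae P, forall t, 0 < X t} -> continuous_rv X ->
  P (frac_rv (log_rv b X) @^-1` [set c]) = 0%E.
Proof.
move=> b1 Xpos Xcont.
pose C : set R := range (fun n : int => b%:R `^ (n%:~R + c)).
have C_null : P.-negligible (X @^-1` C).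
  have cC : countable C by exact: sub_countable (card_image_le _ _) (countableP _).
  apply/negligibleP; last exact: continuous_rv_countable_null.
  rewrite -[X @^-1` C]setTI; apply: measurable_funP => //.
  exact: countable_measurable.
apply: measure_negligible.
  by rewrite -[_ @^-1` _]setTI; apply: measurable_funP.
apply: negligibleS (negligibleU Xpos C_null) => t /= Zc.
have [Xt|nXt] := pselect (0 < X t); [right|by left].
(* The integer part of [log_b X] and its fractional part [c] determine [X]. *)
exists (Num.floor (logb b (X t))) => //.
by rewrite -Zc /= /frac addrC subrK powR_logb.
Qed.

(** Without atoms [cdf Z r] is also the probability of [Z < r], and the event
    [Z < v] is the disjoint union of [Z < u] and [u <= Z < v]. *)
Lemma cdf_sub_atomless (d : measure_display) (T : measurableType d)
    (R : realType) (P : probability T R) (Z : {RV P >-> R}) (u v : R) :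
  (forall c, P (Z @^-1` [set c]) = 0%E) -> u <= v ->
  P [set t | u <= Z t < v] = (cdf Z v - cdf Z u)%E.
Proof.
move=> Z0 uv.
have mZ (i : interval R) : measurable (Z @^-1` [set` i]).
  by rewrite -[_ @^-1` _]setTI; apply: measurable_funP.
have cdf_lt r : cdf Z r = P (Z @^-1` `]-oo, r[).
  rewrite /cdf /distribution /pushforward /= -(@setUitv1 _ _ _ _ true)//.
  by rewrite preimage_setU measureU0//; exact: Z0.
have -> : [set t | u <= Z t < v] = Z @^-1` `[u, v[.
  by apply/seteqP; split=> t /=; rewrite in_itv.
rewrite !cdf_lt (@itv_bndbnd_setU _ _ -oo%O (BLeft u) (BLeft v))//.
rewrite preimage_setU measureU//; last first.
  rewrite -preimage_setI; apply/seteqP; split=> t //=.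
  by rewrite !in_itv/= => -[+ /andP[+ _]] => /lt_geF ->.
(* Subtraction of extended reals cancels only at finite values. *)
rewrite addeAC subee ?add0e//.
exact: fin_num_measure.
Qed.

Theorem theorem2p1 (d : measure_display) (T : measurableType d) (R : realType)
    (P : probability T R) (b k : nat) (hb : (2 <= b)%N) (hk : (1 <= k)%N)
    (X : {RV P >-> R})
    (X_pos : {ae P, forall t, 0 < X t})
    (X_cont : continuous_rv X)
    (a : nat) (ha : (b ^ (k - 1) <= a <= b ^ k - 1)%N) :
  let Y : {RV P >-> R} := log_rv b X in
  P [set t | significand b k X t = a%:Z] =
    (cdf (frac_rv Y) (logb b (a + 1)%:R - k%:R + 1)
     - cdf (frac_rv Y) (logb b a%:R - k%:R + 1))%E.
Proof.
move=> Y.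
have a0 : (0 < a)%N.
  by case/andP: ha => + _; apply: leq_trans; rewrite expn_gt0 ltnW.
have -> : [set t | significand b k X t = a%:Z] =
    [set t | logb b a%:R - k%:R + 1 <= frac_rv Y t
             < logb b (a + 1)%:R - k%:R + 1].
  apply/seteqP; split=> t; rewrite /= -significand_eq_logb//; first by move/eqP.
  by move/eqP.
apply: cdf_sub_atomless => [c|]; first exact: frac_log_atomless.
rewrite lerD2r lerD2r /logb ler_pM2r ?invr_gt0 ?ln_nat_gt0//.
by rewrite ler_ln ?posrE ?ltr0n ?ler_nat ?addn1.
Qed.
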